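(* Fix $q\in(0,1)$ and let $(\Gamma_n)$ be a sequence of graphs whose vertex cover numbers satisfy $\tau(\Gamma_n)\le\tau_0$ for some constant $\tau_0<\infty$. Let $\Delta_n=d_{\max}(\Gamma_n)$ be the maximum degree of $\Gamma_n$. If $$Q_n=o\left(\frac{n^3}{\Delta_n^2}\right),$$ then weak detection is impossible with query budget $Q_n$.
   Context: Setup. $\Gamma_n$ is a finite simple undirected graph without isolated vertices and with at least one edge, with $|v(\Gamma_n)|\le n$. The vertex cover number $\tau(\Gamma_n)$ is the minimum size of a set of vertices meeting every edge. Under $\mathcal H_0$, $G$ is a random graph on $[n]=\{1,\dots,n\}$ in which each pair in $\binom{[n]}{2}$ is an edge independently with probability $q$. Under $\mathcal H_1$, a copy $\Gamma_n^\star$ is drawn uniformly from the set of all subgraphs of the complete graph on $[n]$ isomorphic to $\Gamma_n$; all edges of $\Gamma_n^\star$ are in $G$, and every other pair is an edge independently with probability $q$. For a query set $\mathcal Q\subseteq\binom{[n]}{2}$ (chosen non-adaptively), the transcript is $G_{\mathcal Q}=(\mathbf 1\{e\in e(G)\})_{e\in\mathcal Q}$, with laws $\mathbb P_{\mathcal H_0,\mathcal Q}$, $\mathbb P_{\mathcal H_1,\mathcal Q}$. The optimal risk under budget $Q_n$ is $R^\star_{n,Q_n}=1-\sup_{|\mathcal Q|\le Q_n} d_{\mathrm{TV}}(\mathbb P_{\mathcal H_1,\mathcal Q},\mathbb P_{\mathcal H_0,\mathcal Q})$. Weak detection is impossible with budget $Q_n$ if $\lim_nR^\star_{n,Q_n}=1$.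 *)

(* Defs.v *)
From HB Require Import structures.
From mathcomp Require Import all_boot all_order all_algebra.
From mathcomp Require Import all_classical all_reals all_analysis.

Set Implicit Arguments.
Unset Strict Implicit.
Unset Printing Implicit Defensive.

Import Order.TTheory GRing.Theory Num.Theory.
Import numFieldNormedType.Exports.
Local Open Scope ring_scope.

Record sgraph := SGraph {
  vert : finType;
  adj : rel vert;
  adj_sym : symmetric adj;
  adj_irr : irreflexive adj }.

Definition edges (Gam : sgraph) : {set {set vert Gam}} :=
  [set e : {set vert Gam} | [exists x, exists y, adj x y && (e == [set x; y])]].

Definition no_isolated (Gam : sgraph) : Prop :=
  forall x : vert Gam, exists y, adj x y.

Definition is_vertex_cover (Gam : sgraph) (C : {set vert Gam}) : bool :=
  [forall e in edges Gam, ~~ [disjoint e & C]].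

(* The default value of the minimum is harmless: the whole vertex set is a
   vertex cover, of exactly that size. *)
Definition vertex_cover_number (Gam : sgraph) : nat :=
  \big[minn/#|vert Gam|]_(C : {set vert Gam} | is_vertex_cover C) #|C|.

Definition max_degree (Gam : sgraph) : nat :=
  (\max_(x : vert Gam) #|[set y | adj x y]|)%N.

Definition pairs (n : nat) : {set {set 'I_n}} := [set e : {set 'I_n} | #|e| == 2%N].

(* A subgraph of the complete graph on 'I_n is a pair (vertex set, edge set);
   it is isomorphic to Gam iff it is the image of Gam under an injection of the
   vertices.  Distinct injections with the same image count once. *)
Definition copies (Gam : sgraph) (n : nat) :
    {set {set 'I_n} * {set {set 'I_n}}} :=
  [set H | [exists f : {ffun vert Gam -> 'I_n},
     [&& injectiveb f,
         H.1 == [set f x | x : vert Gam] &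
         H.2 == [set [set f x | x in e] | e : {set vert Gam} in edges Gam]]]].

Section Laws.
Variables (R : realType) (q : R) (n : nat).

(* A graph on 'I_n is represented by its edge set, a subset of [pairs n]. *)
Definition graph_law0 (E : {set {set 'I_n}}) : R :=
  \prod_(e in pairs n) (if e \in E then q else 1 - q).

Definition planted_law (S E : {set {set 'I_n}}) : R :=
  \prod_(e in pairs n)
    (if e \in S then (e \in E)%:R else if e \in E then q else 1 - q).

Definition graph_law1 (Gam : sgraph) (E : {set {set 'I_n}}) : R :=
  (#|copies Gam n|%:R)^-1 * \sum_(H in copies Gam n) planted_law H.2 E.

Definition transcript (Q E : {set {set 'I_n}}) :
    {ffun {e : {set 'I_n} | e \in Q} -> bool} :=
  [ffun e => val e \in E].

Definition transcript_law (P : {set {set 'I_n}} -> R) (Q : {set {set 'I_n}})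
    (t : {ffun {e : {set 'I_n} | e \in Q} -> bool}) : R :=
  \sum_(E in powerset (pairs n) | transcript Q E == t) P E.

Definition dTV (T : finType) (P1 P0 : T -> R) : R :=
  2^-1 * \sum_(t : T) `|P1 t - P0 t|.

Definition optimal_risk (Gam : sgraph) (b : nat) : R :=
  1 - sup [set dTV (@transcript_law (graph_law1 Gam) Q)
                   (@transcript_law graph_law0 Q)
          | Q in [set Q : {set {set 'I_n}} | Q \subset pairs n /\ (#|Q| <= b)%N]]%classic.

End Laws.

Definition weak_detection_impossible (R : realType) (q : R)
    (Gam : nat -> sgraph) (b : nat -> nat) : Prop :=
  ((fun n => optimal_risk q n (Gam n) (b n)) @ \oo --> (1 : R))%classic.

(* Main.v *)
(* A vertex cover of Gam has at most tau0 vertices, so a copy of Gam consists of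
   boundedly many centres, boundedly many inner edges between centres, and
   outer edges joining a centre to one of at most tau0 * Delta leaves.

   Outer edges.  Reveal the positions of the centres.  Two independent placements
   of the leaves overlap, within the vertices v whose pair with some centre is
   queried, in a set whose exponential moments are at most those of a binomial
   variable with #{v} trials of success probability (tau0 Delta / (n - tau0))^2.  A centre is
   uniform, so it meets 2 |Q| / n queries on average, and the mean is of order
   Delta^2 |Q| / n^3 = o(1).  By the second moment method the outer edges are
   undetectable even when the centres are known.

   Inner edges.  Two independent copies share an inner edge only if they share
   a centre, which has probability O(1/n); the second moment is 1 + O(1/n), even
   if all pairs are queried.  The triangle inequality combines the two steps. *)

Require Import Defs.
From HB Require Import structures.
From mathcomp Require Import all_boot all_order all_algebra.
From mathcomp Require Import fingroup perm.
From mathcomp Require Import all_classical all_reals all_analysis.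
From mathcomp Require Import ring lra.

Set Implicit Arguments.
Unset Strict Implicit.
Unset Printing Implicit Defensive.

Import Order.TTheory GRing.Theory Num.Theory.
Import numFieldNormedType.Exports.
Local Open Scope ring_scope.

(** * Averages over finite sets *)

Section Average.
Variables (R : realType) (I : finType).
Implicit Types (A : {set I}) (F G : I -> R).

Definition avg A F : R := #|A|%:R^-1 * \sum_(i in A) F i.

Lemma avg_le A F G : (forall i, i \in A -> F i <= G i) -> avg A F <= avg A G.
Proof. by move=> le_FG; rewrite ler_wpM2l ?invr_ge0 ?ler0n ?ler_sum. Qed.

Lemma eq_avg A F G : (forall i, i \in A -> F i = G i) -> avg A F = avg A G.
Proof. by move=> eq_FG; congr (_ * _); apply: eq_bigr. Qed.

Lemma avg_const A (c : R) : (0 < #|A|)%N -> avg A (fun=> c) = c.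
Proof.
move=> A0; rewrite /avg sumr_const -[c *+ _]mulr_natl mulrA mulVf ?mul1r //.
by rewrite pnatr_eq0 -lt0n.
Qed.

Lemma avgD A F G : avg A (fun i => F i + G i) = avg A F + avg A G.
Proof. by rewrite /avg big_split mulrDr. Qed.

Lemma avgB A F G : avg A (fun i => F i - G i) = avg A F - avg A G.
Proof. by rewrite /avg sumrB mulrBr. Qed.

Lemma avgZ A (c : R) F : avg A (fun i => c * F i) = c * avg A F.
Proof. by rewrite /avg -mulr_sumr mulrCA. Qed.

Lemma avg_sum (J : finType) (P : pred J) A (F : J -> I -> R) :
  avg A (fun i => \sum_(j | P j) F j i) = \sum_(j | P j) avg A (F j).
Proof. by rewrite /avg exchange_big mulr_sumr. Qed.

Lemma ler_norm_avg A F : `|avg A F| <= avg A (fun i => `|F i|).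
Proof.
by rewrite normrM ger0_norm ?invr_ge0 ?ler0n // ler_wpM2l ?invr_ge0 ?ler0n ?ler_norm_sum.
Qed.

End Average.

(** * Product weights on edge sets and planted laws *)

Lemma sum_powerset_prod (R : comNzRingType) (T : finType) (P : {set T})
    (F : T -> bool -> R) :
  \sum_(E in powerset P) \prod_(e in P) F e (e \in E)
  = \prod_(e in P) (F e true + F e false).
Proof.
(* Outside [P] the weights are 0 for presence and 1 for absence, so the expansion over all subsets
   of [T] keeps exactly the subsets of [P]. *)
pose F1 e := if e \in P then F e true else 0.
pose F0 e := if e \in P then F e false else 1.
transitivity (\prod_e (F1 e + F0 e)); last first.
  rewrite [RHS]big_mkcond; apply: eq_bigr => e _; rewrite /F1 /F0.
  by case: ifP => // _; rewrite add0r.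
rewrite (bigA_distr 1 (@GRing.add R)) /= big_mkcond; apply: eq_bigr => E _.
rewrite powersetE; case: (boolP (E \subset P)) => [sEP|].
  rewrite big_mkcond; apply: eq_bigr => e _; rewrite /F1 /F0.
  by case: (boolP (e \in P)) => eP; case: ifP => // eE; rewrite (fintype.subsetP sEP) in eP.
case/subsetPn=> e eE eP; rewrite (bigD1 e) //= eE /F1 (negbTE eP) mul0r //.
Qed.

Section Planted.
Variables (R : realType) (q : R) (n : nat).
Hypotheses (q0 : 0 < q) (q1 : q < 1).
Local Notation eset := {set {set 'I_n}}.
Implicit Types (S B E Q : eset).

Definition edge_weight S (e : {set 'I_n}) (b : bool) : R :=
  if e \in S then b%:R else if b then q else 1 - q.

Lemma planted_lawE S E :
  planted_law q S E = \prod_(e in pairs n) edge_weight S e (e \in E).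
Proof. by []. Qed.

Lemma edge_weight_sum S e : edge_weight S e true + edge_weight S e false = 1.
Proof. by rewrite /edge_weight; case: ifP => _ /=; rewrite ?addr0 ?subrKC //. Qed.

Lemma edge_weight_ge0 S e b : 0 <= edge_weight S e b.
Proof. by rewrite /edge_weight; case: ifP => _; case: b => //=;
  rewrite ?ler01 ?(ltW q0) ?subr_ge0 ?(ltW q1). Qed.

Lemma planted_law_ge0 S E : 0 <= planted_law q S E.
Proof. by rewrite planted_lawE prodr_ge0 // => e _; apply: edge_weight_ge0. Qed.

Lemma planted_law_sum S : \sum_(E in powerset (pairs n)) planted_law q S E = 1.
Proof.
rewrite (sum_powerset_prod (pairs n) (edge_weight S)) big1 // => e _.
exact: edge_weight_sum.
Qed.

Lemma planted_law_set0 E : planted_law q finset.set0 E = graph_law0 q E.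
Proof. by apply: eq_bigr => e _; rewrite inE. Qed.

(** Edges are independent under a planted law, and each unqueried pair sums to 1 whether planted or
    not. Hence only the planted edges in [Q] influence the transcript. *)
Lemma transcript_planted Q S t : Q \subset pairs n ->
  @transcript_law R n (planted_law q S) Q t
  = @transcript_law R n (planted_law q (S :&: Q)) Q t.
Proof.
move=> sQP.
(* [u] extends [t] by [false] outside [Q], and [h] tests agreement with [t] at one pair; the event
   that the transcript equals [t] thus becomes a product over pairs. *)
pose u e := if insub e is Some x then t x else false.
pose h e b : R := if e \in Q then (b == u e)%:R else 1.
have trE E : (transcript Q E == t)%:R = \prod_(e in pairs n) h e (e \in E).
  case: eqP => [tE|/eqP tE].
    rewrite big1 // => e _; rewrite /h; case: ifP => // eQ.
    by rewrite /u insubT -tE ffunE /= eqxx.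
  have [x xP] : exists x, transcript Q E x != t x.
    by apply/existsP; apply: contraNT tE; rewrite negb_exists => /forallP tE;
       apply/eqP/ffunP => x; apply/eqP; rewrite -[_ == _]negbK tE.
  have xQ := valP x.
  rewrite (bigD1 (val x)) ?(fintype.subsetP sQP) //= /h xQ /u valK.
  by move: xP; rewrite ffunE => /negbTE ->; rewrite mul0r.
have trL S' : @transcript_law R n (planted_law q S') Q t =
    \prod_(e in pairs n) (edge_weight S' e true * h e true
                          + edge_weight S' e false * h e false).
  rewrite -(sum_powerset_prod (pairs n) (fun e b => edge_weight S' e b * h e b)).
  rewrite /transcript_law big_mkcondr; apply: eq_bigr => E _.
  rewrite big_split /= -trE planted_lawE.
  by case: eqP => _; rewrite ?mulr1 ?mulr0.
rewrite !trL; apply: eq_bigr => e _; rewrite /edge_weight inE /h.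
by case: (e \in Q); rewrite ?andbT // ?andbF; case: (e \in S) => /=; rewrite ?mulr1; lra.
Qed.

End Planted.

(** * Total variation distance between transcripts *)

Section TotalVariation.
Variables (R : realType) (n : nat).
Local Notation eset := {set {set 'I_n}}.
Implicit Types (Q : eset) (P : eset -> R).

Lemma dTV_triangle (T : finType) (P1 P2 P3 : T -> R) :
  dTV P1 P3 <= dTV P1 P2 + dTV P2 P3.
Proof.
rewrite /dTV -mulrDr ler_wpM2l // -big_split ler_sum // => t _.
exact: ler_distD.
Qed.

Definition transcript_dTV Q P1 P0 : R :=
  dTV (@transcript_law R n P1 Q) (@transcript_law R n P0 Q).

(** Joint convexity of total variation: revealing the index of a mixture can only help detection. *)
Lemma transcript_dTV_avg (I : finType) (A : {set I}) Q (P1 P0 : I -> eset -> R) :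
  transcript_dTV Q (fun E => avg A (P1^~ E)) (fun E => avg A (P0^~ E))
  <= avg A (fun i => transcript_dTV Q (P1 i) (P0 i)).
Proof.
rewrite /transcript_dTV /dTV avgZ avg_sum ler_wpM2l // ler_sum // => t _.
by rewrite /transcript_law -!avg_sum -avgB ler_norm_avg.
Qed.

Lemma sum_transcript Q (F : eset -> R) :
  \sum_t \sum_(E in powerset (pairs n) | transcript Q E == t) F E
  = \sum_(E in powerset (pairs n)) F E.
Proof. by rewrite [RHS](partition_big (transcript Q) predT). Qed.

(** Data processing: the transcript is a function of the graph. *)
Lemma transcript_dTV_le Q P1 P0 :
  transcript_dTV Q P1 P0 <= 2^-1 * \sum_(E in powerset (pairs n)) `|P1 E - P0 E|.
Proof.
rewrite /transcript_dTV /dTV ler_wpM2l // -(sum_transcript Q) ler_sum // => t _.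
by rewrite /transcript_law -sumrB ler_norm_sum.
Qed.

Lemma transcript_dTV_le1 Q P1 P0 :
    (forall E, 0 <= P1 E) -> (forall E, 0 <= P0 E) ->
    \sum_(E in powerset (pairs n)) P1 E = 1 ->
    \sum_(E in powerset (pairs n)) P0 E = 1 ->
  transcript_dTV Q P1 P0 <= 1.
Proof.
move=> P1_ge0 P0_ge0 sum1 sum0; apply: le_trans (transcript_dTV_le _ _ _) _.
rewrite ler_pdivrMl // mulr1; apply: le_trans (_ : _ <= 1 + 1) _; last by lra.
rewrite -{1}sum1 -sum0 -big_split ler_sum // => E _.
by rewrite (le_trans (ler_normB _ _)) // !ger0_norm.
Qed.

Lemma transcript_dTV_triangle Q P1 P2 P3 :
  transcript_dTV Q P1 P3 <= transcript_dTV Q P1 P2 + transcript_dTV Q P2 P3.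
Proof. exact: dTV_triangle. Qed.

Lemma eq_transcript_dTV Q P1 P1' P0 P0' : P1 =1 P1' -> P0 =1 P0' ->
  transcript_dTV Q P1 P0 = transcript_dTV Q P1' P0'.
Proof. by move=> e1 e0; rewrite (funext e1) (funext e0). Qed.

End TotalVariation.

(** * The second moment method, relative to a common planted set [B] *)

Section SecondMoment.
Variables (R : realType) (q : R) (n : nat).
Hypotheses (q0 : 0 < q) (q1 : q < 1).
Local Notation eset := {set {set 'I_n}}.
Variables (I : finType) (A : {set I}) (S : I -> eset) (B : eset).
Hypotheses (A0 : (0 < #|A|)%N) (sBS : forall i, i \in A -> B \subset S i)
  (sSP : forall i, i \in A -> S i \subset pairs n).

(** One factor of the density of planting [S i] with respect to planting [B]; the edges of [B] are
    present under both laws and contribute 1. *)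
Definition edge_ratio i (e : {set 'I_n}) (b : bool) : R :=
  if e \in S i :\: B then b%:R / q else 1.

Definition lik_ratio i (E : eset) : R :=
  \prod_(e in pairs n) edge_ratio i e (e \in E).

Lemma planted_lik_ratio i E : i \in A ->
  planted_law q (S i) E = planted_law q B E * lik_ratio i E.
Proof.
move=> iA; rewrite -big_split; apply: eq_bigr => e _ /=.
rewrite /edge_ratio inE; have := fintype.subsetP (sBS iA) e.
case: (e \in B) => [->//|_] /=; first by rewrite mulr1.
case: (e \in S i) => /=; last by rewrite mulr1.
by case: (e \in E); rewrite /= ?mul0r ?mulr0 // mul1r mulfV ?gt_eqF.
Qed.

Lemma sum_lik_ratio i : i \in A ->
  \sum_(E in powerset (pairs n)) planted_law q B E * lik_ratio i E = 1.
Proof.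
move=> iA; rewrite -(planted_law_sum q (S i)); apply: eq_bigr => E _.
by rewrite planted_lik_ratio.
Qed.

(** The expectation factors over pairs. Outside [B], a pair in both planted sets contributes
    [q * (1 / q) ^ 2], a pair in only one contributes [q * (1 / q)], and all other factors are 1. *)
Lemma sum_lik_ratio2 i j : i \in A -> j \in A ->
  \sum_(E in powerset (pairs n)) planted_law q B E * (lik_ratio i E * lik_ratio j E)
  = q^-1 ^+ #|(S i :&: S j) :\: B|.
Proof.
move=> iA jA.
pose F e b := edge_weight q B e b * (edge_ratio i e b * edge_ratio j e b).
transitivity (\sum_(E in powerset (pairs n)) \prod_(e in pairs n) F e (e \in E)).
  by apply: eq_bigr => E _; rewrite !big_split.
have sub : (S i :&: S j) :\: B \subset pairs n.
  by apply: fintype.subset_trans (sSP iA); apply/fintype.subsetP => e;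
    rewrite !inE => /and3P[].
rewrite sum_powerset_prod -prodr_const.
rewrite (big_setID ((S i :&: S j) :\: B)) /= [X in _ * X]big1 ?mulr1.
  rewrite (finset.setIidPr sub); apply: eq_bigr => e; rewrite !inE => /and3P[eB ei ej].
  rewrite /F /edge_weight /edge_ratio !inE (negbTE eB) ei ej /= mul1r !mul0r !mulr0 addr0.
  by rewrite mulrA mulfV ?gt_eqF ?mul1r.
move=> e; rewrite !inE /F /edge_weight /edge_ratio !inE => /andP[+ _].
have qq : q != 0 by rewrite gt_eqF.
by case: (e \in B) => /=; case: (e \in S i) => /=; case: (e \in S j) => //= _;
  rewrite !(mulr1, mul1r, mul0r, mulr0, addr0) ?subrKC ?(divff qq).
Qed.

(* AM-GM in the form [2 |g - 1| <= (g - 1)^2 / eta + eta] replaces the square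
   root of the usual bound of the total variation by the chi-square distance. *)
Lemma second_moment_bound (eta : R) : 0 < eta ->
  \sum_(E in powerset (pairs n)) `|avg A (fun i
    => planted_law q (S i) E) - planted_law q B E|
  <= 2^-1 * ((avg A (fun i => avg A (fun j => q^-1 ^+ #|(S i :&: S j)
    :\: B|)) - 1) / eta + eta).
Proof.
move=> eta0; pose g E := avg A (lik_ratio^~ E).
have gE E : avg A (fun i => planted_law q (S i) E) = planted_law q B E * g E.
  by rewrite -avgZ; apply: eq_avg => i iA; rewrite planted_lik_ratio.
pose p := planted_law q B.
have sg : \sum_(E in powerset (pairs n)) p E * g E = 1.
  rewrite -[RHS](avg_const 1 A0) -(eq_avg sum_lik_ratio) avg_sum.
  by apply: eq_bigr => E _; rewrite avgZ.
have sgg : \sum_(E in powerset (pairs n)) p E * (g E * g E) =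
    avg A (fun i => avg A (fun j => q^-1 ^+ #|(S i :&: S j) :\: B|)).
  have -> : avg A (fun i => avg A (fun j => q^-1 ^+ #|(S i :&: S j) :\: B|)) =
    avg A (fun i => avg A (fun j => \sum_(E in powerset (pairs n))
       planted_law q B E * (lik_ratio i E * lik_ratio j E))).
    by apply: eq_avg => i iA; apply: eq_avg => j jA; rewrite sum_lik_ratio2.
  under [RHS]eq_avg => i _ do rewrite avg_sum.
  rewrite avg_sum; apply: eq_bigr => E _.
  under [RHS]eq_avg => i _ do rewrite avgZ avgZ.
  rewrite avgZ; congr (_ * _); rewrite /g -avgZ.
  by apply: eq_avg => i _; rewrite mulrC.
have -> : 2^-1 * ((avg A (fun i => avg A (fun j => q^-1 ^+ #|(S i :&: S j)
  :\: B|)) - 1) / eta + eta) =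
  \sum_(E in powerset (pairs n)) p E * (2^-1 * ((g E - 1) * (g E - 1) / eta + eta)).
  transitivity (\sum_(E in powerset (pairs n)) ((2 * eta)^-1 * (p E * (g E * g E))
      - eta^-1 * (p E * g E) + ((2 * eta)^-1 + 2^-1 * eta) * p E)).
    rewrite big_split sumrB -!mulr_sumr sg sgg planted_law_sum /=.
    by field; rewrite gt_eqF.
  by apply: eq_bigr => E _; field; rewrite gt_eqF.
apply: ler_sum => E _; rewrite gE -/p.
have p0 : 0 <= p E by apply: planted_law_ge0.
have -> : p E * g E - p E = p E * (g E - 1) by rewrite mulrBr mulr1.
rewrite normrM ger0_norm // ler_wpM2l // ler_pdivlMl //.
rewrite -[leRHS](_ : (`|g E - 1| ^+ 2 + eta ^+ 2) / eta = _); last first.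
  rewrite real_normK ?num_real // mulrDl !expr2 mulfK // gt_eqF //.
rewrite ler_pdivlMr // -subr_ge0.
have -> : `|g E - 1| ^+ 2 + eta ^+ 2 - 2 * `|g E - 1| * eta = (`|g E - 1| - eta) ^+ 2 by ring.
exact: sqr_ge0.
Qed.

End SecondMoment.

(** * Binomial expansion over subsets and a reverse Bernoulli inequality *)

Lemma sum_powerset_exp (R : comNzRingType) (T : finType) (X : {set T}) (x : R) :
  \sum_(S in powerset X) x ^+ #|S| = (1 + x) ^+ #|X|.
Proof.
rewrite -prodr_const; under [RHS]eq_bigr do rewrite addrC.
rewrite -(sum_powerset_prod X (fun _ b => if b then x else 1)).
apply: eq_bigr => S; rewrite powersetE => sSX.
by rewrite -big_mkcondr -prodr_const; apply: eq_bigl => e;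
  rewrite andbC; case: (boolP (e \in S)) => // /(fintype.subsetP sSX) ->.
Qed.

(** Induction on [k]: the bound 1/2 keeps the cross term [2 * (k * x) * x] below [x], so each step
    adds at most [2 * x]. *)
Lemma Bernoulli_upper (R : realFieldType) (x : R) (k : nat) :
  0 <= x -> k%:R * x <= 2^-1 -> (1 + x) ^+ k <= 1 + 2 * (k%:R * x).
Proof.
move=> x0; elim: k => [|k IHk]; first by rewrite expr0 mul0r mulr0 addr0.
rewrite -natr1 mulrDl mul1r => kx; have kx' : k%:R * x <= 2^-1 by lra.
rewrite exprSr; apply: le_trans (ler_wpM2r _ (IHk kx')) _; first by lra.
have : (2 * (k%:R * x)) * x <= 1 * x by rewrite ler_wpM2r //; lra.
lra.
Qed.

(** * Uniform random permutations *)

Section PermAverage.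
Variables (R : realType) (T : finType).
Local Notation perms := [set: {perm T}].

Lemma avg_perm_mull (s : {perm T}) (F : {perm T} -> R) :
  avg perms (fun p => F (s * p)%g) = avg perms F.
Proof.
rewrite /avg; congr (_ * _); rewrite [RHS](reindex_inj (mulgI s)) /=.
by apply: eq_bigl => p; rewrite !inE.
Qed.

Lemma card_perms_gt0 : (0 < #|perms|)%N.
Proof. by apply/card_gt0P; exists 1%g; rewrite inE. Qed.

(** Composing with transpositions shows that the left side does not depend on [i]. It may therefore
    be averaged over [i] too, and for fixed [p] the point [p i] then runs once through [T]. *)
Lemma avg_perm_apply (h : T -> R) (i : T) :
  avg perms (fun p => h (p i)) = avg [set: T] h.
Proof.
rewrite -[LHS](@avg_const _ _ [set: T]); last by apply/card_gt0P; exists i; rewrite inE.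
transitivity (avg [set: T] (fun j => avg perms (fun p => h (p j)))).
  apply: eq_avg => j _; rewrite -(avg_perm_mull (tperm i j)).
  by apply: eq_avg => p _; rewrite permM tpermL.
rewrite {1}/avg -avg_sum -avgZ -[RHS](avg_const _ card_perms_gt0).
apply: eq_avg => p _; rewrite /avg; congr (_ * _).
by rewrite [RHS](reindex_inj (@perm_inj _ p)); apply: eq_bigl => j; rewrite !inE.
Qed.

(** This allows two-stage sampling: later [p] places the centres, and [s], which fixes them,
    redistributes the leaves. *)
Lemma avg_perm_split (A : {set {perm T}}) (F : {perm T} -> R) : (0 < #|A|)%N ->
  avg perms F = avg perms (fun p => avg A (fun s => F (s * p)%g)).
Proof.
move=> A0; rewrite -[LHS](avg_const _ A0).
transitivity (avg A (fun s => avg perms (fun p => F (s * p)%g))).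
  by apply: eq_avg => s _; rewrite avg_perm_mull.
by rewrite {1}/avg -avg_sum -avgZ.
Qed.

End PermAverage.

(** * Overlap of two independent random subsets *)

Section RandomSubset.
Variables (R : realType) (T : finType) (U L : {set T}).
Hypotheses (sLU : L \subset U).
Implicit Type S : {set T}.
(** The image of [L] under a uniform element of this set models a uniform subset of [U] of size
    [#|L|]. *)
Definition perms_on : {set {perm T}} := [set s | perm_on U s].
Local Notation K := perms_on.
Local Notation r := (#|L|%:R / #|U|%:R : R).

Lemma perms_on_gt0 : (0 < #|K|)%N.
Proof. by apply/card_gt0P; exists 1%g; rewrite inE perm_on1. Qed.

Definition cover_prob (S : {set T}) : R :=
  avg K (fun s => (S \subset [set s x | x in L])%:R).

Lemma cover_prob_ge0 S : 0 <= cover_prob S.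
Proof. by rewrite mulr_ge0 ?invr_ge0 ?ler0n // sumr_ge0. Qed.

Lemma imset_perm_on s : s \in K -> [set s x | x in L] \subset U.
Proof.
rewrite inE => sU; apply/fintype.subsetP => _ /imsetP[x xL ->].
by rewrite perm_closed // (fintype.subsetP sLU).
Qed.

(** Composition with the transposition of [v] and [w] permutes [K], fixes [S] pointwise and swaps
    the two events. *)
Lemma cover_prob_exchange S v w : v \in U -> w \in U -> v \notin S -> w \notin S ->
  cover_prob (v |: S) = cover_prob (w |: S).
Proof.
move=> vU wU vS wS; rewrite /cover_prob /avg; congr (_ * _).
have tU : perm_on U (tperm v w).
  by apply/fintype.subsetP => x; rewrite inE; case: tpermP => [->|->|]; rewrite ?eqxx.
rewrite [RHS](reindex_inj (mulIg (tperm v w))) /=; apply: eq_big => [s|s _].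
  rewrite !inE; apply/idP/idP => [sU|]; first exact: perm_onM.
  by move=> /perm_onM /(_ tU); rewrite -mulgA tperm2 mulg1.
congr ((_ : bool)%:R).
have -> : [set (s * tperm v w)%g x | x in L] = [set tperm v w x | x in [set s x | x in L]].
  by rewrite -imset_comp; apply: eq_imset => x; rewrite permM.
have -> : w |: S = [set tperm v w x | x in v |: S].
  rewrite imsetU1 tpermL; congr (_ |: _).
  rewrite -[LHS]imset_id; apply: eq_in_imset => x xS.
  by rewrite tpermD //; apply: contraNneq (vS) => e; [rewrite e | move: wS; rewrite e xS].
apply/idP/idP => [|/fintype.subsetP sub]; first exact: imsetS.
apply/fintype.subsetP => x xS.
have /sub : tperm v w x \in [set tperm v w x | x in v |: S] by rewrite imset_f.
by case/imsetP => y ys /perm_inj ->.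
Qed.

(** Double counting of the points [w] of [U] outside [S]: by exchangeability each gives the same
    probability, while an image of [L] containing [S] has exactly [#|L| - #|S|] further points. *)
Lemma cover_prob_step S v : S \subset U -> v \in U -> v \notin S ->
  (#|U|%:R - #|S|%:R) * cover_prob (v |: S) = (#|L|%:R - #|S|%:R) * cover_prob S.
Proof.
move=> sSU vU vS.
have -> : #|U|%:R - #|S|%:R = #|U :\: S|%:R :> R.
  by rewrite -(cardsID S U) (finset.setIidPr sSU) natrD addrAC subrr add0r.
transitivity (\sum_(w in U :\: S) cover_prob (w |: S)).
  rewrite mulr_natl -sumr_const; apply: eq_bigr => w; rewrite inE => /andP[wS wU].
  exact: cover_prob_exchange.
rewrite -avg_sum -avgZ; apply: eq_avg => s sK.
have [sub|nsub] := boolP (S \subset _); last first.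
  rewrite mulr0 big1 // => w _; case: (boolP (_ \subset _)) => // sub.
  by case/negP: nsub; apply: fintype.subset_trans sub; apply: finset.subsetUr.
rewrite mulr1; under eq_bigr => w _ do rewrite finset.subUset finset.sub1set sub andbT.
rewrite -natr_sum -big_mkcondr sum1dep_card -(card_imset L (@perm_inj _ s)).
rewrite -[in RHS](cardsID S [set s x | x in L]) (finset.setIidPr sub) natrD.
rewrite addrAC subrr add0r; congr (_%:R); apply: eq_card => w; rewrite !inE.
by case: (boolP (w \in S)) => //= _; case: (boolP (w \in [set _ | _ in _]))
  => /= [/(fintype.subsetP (imset_perm_on sK)) ->|_]; rewrite ?andbF.
Qed.

(** Sampling without replacement is dominated by sampling with replacement: adding a point to a set
    of size [k] costs the factor [(#|L| - k) / (#|U| - k)], which is at most [r] because [L] is no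
    larger than [U]. *)
Lemma cover_prob_le S : cover_prob S <= r ^+ #|S|.
Proof.
have [sSU|/subsetPn[x xS xU]] := boolP (S \subset U); last first.
  rewrite [cover_prob S](_ : _ = 0) ?exprn_ge0 ?divr_ge0 //.
  rewrite -(avg_const 0 perms_on_gt0); apply: eq_avg => s sK.
  case: (boolP (_ \subset _)) => // sub; case/negP: xU.
  by apply: (fintype.subsetP (imset_perm_on sK)); apply: (fintype.subsetP sub).
elim: {S}#|S| {-2}S (erefl #|S|) sSU => [|k IHk] S cS sSU.
  rewrite cS expr0 -[leRHS](avg_const 1 perms_on_gt0); apply: avg_le => s _.
  by case: (_ \subset _).
have /card_gt0P[v vS] : (0 < #|S|)%N by rewrite cS.
have vU := fintype.subsetP sSU _ vS.
pose S' := S :\ v.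
have cS' : #|S'| = k by apply/eqP; rewrite -eqSS -cS (cardsD1 v S) vS.
have sSU' : S' \subset U by apply: fintype.subset_trans sSU; apply: finset.subD1set.
have vS' : v \notin S' by rewrite !inE eqxx.
have := cover_prob_step sSU' vU vS'; rewrite finset.setD1K // cS' => step.
have kU : k%:R < #|U|%:R :> R by rewrite ltr_nat -cS (leq_trans _ (subset_leq_card sSU))
  ?cS.
have LU : #|L|%:R <= #|U|%:R :> R by rewrite ler_nat subset_leq_card.
have U0 : 0 < #|U|%:R :> R by apply: le_lt_trans kU; rewrite ler0n.
have le_k : r * cover_prob S' <= r ^+ k.+1.
  by rewrite exprS ler_wpM2l ?divr_ge0 // -[in leRHS]cS'; apply: IHk.
rewrite cS; apply: le_trans le_k.
have -> : cover_prob S = (#|L|%:R - k%:R) * cover_prob S' / (#|U|%:R - k%:R).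
  by rewrite -step mulrC mulKf // subr_eq0 gt_eqF.
rewrite ler_pdivrMr ?subr_gt0 // mulrAC ler_wpM2r ?cover_prob_ge0 //.
rewrite mulrAC ler_pdivlMr // mulrBl mulrBr lerB // mulrC ler_wpM2l //.
Qed.

(** Expand the power over the subsets [S] of the overlap. Since [s] and [s'] are independent, each
    [S] contributes [lam ^+ #|S|] times the square of its covering probability, and the resulting
    bounds sum to a binomial power. *)
Lemma avg_overlap_exp (D : {set T}) (lam : R) : 0 <= lam ->
  avg K (fun s => avg K (fun s' =>
    (1 + lam) ^+ #|[set s x | x in L] :&: [set s' x | x in L] :&: D|))
  <= (1 + lam * r ^+ 2) ^+ #|D|.
Proof.
move=> lam0.
pose c S (s : {perm T}) : R := (S \subset [set s x | x in L])%:R.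
apply: (@le_trans _ _ (\sum_(S in powerset D) lam ^+ #|S| * (cover_prob S * cover_prob S))).
  rewrite le_eqVlt; apply/orP; left; apply/eqP.
  transitivity (avg K (fun s => avg K (fun s' =>
      \sum_(S in powerset D) lam ^+ #|S| * (c S s * c S s')))).
    apply: eq_avg => s _; apply: eq_avg => s' _.
    rewrite -sum_powerset_exp big_mkcond [RHS]big_mkcond; apply: eq_bigr => S _.
    rewrite !powersetE !finset.subsetI /c.
    by case: (S \subset D); rewrite ?andbT ?andbF //;
       do 2![case: (S \subset _)]; rewrite /= ?mulr0 ?mul0r ?mulr0 ?mulr1.
  under eq_avg => s _ do rewrite avg_sum.
  rewrite avg_sum; apply: eq_bigr => S _.
  rewrite -[cover_prob S]/(avg K (c S)) mulrA -(avgZ K _ (c S)).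
  apply: eq_avg => s _; rewrite mulrAC -(avgZ K _ (c S)).
  by apply: eq_avg => s' _; rewrite mulrA.
rewrite -sum_powerset_exp; apply: ler_sum => S _.
rewrite exprMn ler_wpM2l ?exprn_ge0 // -exprM mulnC exprM expr2.
by rewrite ler_pM ?cover_prob_ge0 ?cover_prob_le.
Qed.

End RandomSubset.

(** * Uniform copies as uniform relabellings of one embedding *)

Lemma avg_exchange (R : realType) (I J : finType) (A : {set I}) (B : {set J})
    (F : I -> J -> R) :
  avg A (fun i => avg B (F i)) = avg B (fun j => avg A (F^~ j)).
Proof. by rewrite {1}/avg -avg_sum -avgZ. Qed.

(** List [V] twice, once with the values of [f] first and once with those of [g] first; matching
    equal positions gives the permutation. *)
Lemma perm_extension (T V : finType) (f g : T -> V) : injective f -> injective g ->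
  exists p : {perm V}, forall x, p (f x) = g x.
Proof.
move=> f_inj g_inj.
pose s h := codom h ++ [seq y <- enum V | y \notin codom (h : T -> V)].
have s_uniq h : injective h -> uniq (s h).
  move=> h_inj; rewrite cat_uniq map_inj_uniq ?enum_uniq // filter_uniq ?enum_uniq
    //= andbT.
  by apply/hasPn => y; rewrite mem_filter => /andP[].
have mem_s h y : y \in s h.
  by rewrite mem_cat mem_filter mem_enum andbT; case: (_ \in _).
have size_s h : injective h -> size (s h) = #|V|.
  move=> h_inj; rewrite -(card_uniqP (s_uniq _ h_inj)); apply: eq_card => y.
  by rewrite mem_s.
pose F y := nth y (s g) (index y (s f)).
have lt_index y : (index y (s f) < size (s g))%N.
  by rewrite size_s // -(size_s f) // index_mem mem_s.
have F_inj : injective F.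
  move=> y z /eqP; rewrite /F (set_nth_default z) ?lt_index // nth_uniq ?s_uniq ?lt_index
    //.
  by move=> /eqP eyz; rewrite -(nth_index y (mem_s f y)) eyz nth_index ?mem_s.
exists (perm F_inj) => x; rewrite permE /F /s index_cat codom_f nth_cat.
have xT : (index x (enum T) < size (enum T))%N by rewrite index_mem mem_enum.
rewrite (index_map f_inj) size_codom cardE xT (nth_map x) // nth_index //.
by rewrite mem_enum.
Qed.

Section Copies.
Variables (R : realType) (n : nat) (Gam : sgraph) (f0 : vert Gam -> 'I_n).
Hypothesis f0_inj : injective f0.
Local Notation eset := {set {set 'I_n}}.

Definition relabel (p : {perm 'I_n}) (E : eset) : eset :=
  [set [set p x | x in e] | e : {set 'I_n} in E].

Definition embedded_edges (f : vert Gam -> 'I_n) : eset :=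
  [set [set f x | x in e] | e : {set vert Gam} in edges Gam].

Lemma relabel_mul (p s : {perm 'I_n}) E : relabel (s * p)%g E = relabel p (relabel s E).
Proof.
rewrite /relabel -imset_comp; apply: eq_imset => e /=.
by rewrite -imset_comp; apply: eq_imset => x; rewrite permM.
Qed.

Lemma relabel_embedded (p : {perm 'I_n}) f :
  relabel p (embedded_edges f) = embedded_edges (fun x => p (f x)).
Proof.
rewrite /relabel /embedded_edges -imset_comp; apply: eq_imset => e /=.
by rewrite -imset_comp; apply: eq_imset => x.
Qed.

Lemma copiesP (H : {set 'I_n} * eset) :
  reflect (exists2 f : vert Gam -> 'I_n, injective f &
    H = ([set f x | x : vert Gam], embedded_edges f)) (H \in copies Gam n).
Proof.
rewrite inE; apply: (iffP existsP)
  => [[f /and3P[/injectiveP f_inj /eqP e1 /eqP e2]]|[f f_inj ->]].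
  by exists f => //; case: H e1 e2 => H1 H2 /= -> ->.
exists [ffun x => f x] => /=; apply/and3P; split.
- by apply/injectiveP => x y; rewrite !ffunE => /f_inj.
- by apply/eqP/eq_imset => x; rewrite ffunE.
- by apply/eqP/eq_imset => e; apply: eq_imset => x; rewrite ffunE.
Qed.

Definition relabel_pair (p : {perm 'I_n}) (H : {set 'I_n} * eset) :=
  ([set p x | x in H.1], relabel p H.2).

Lemma relabel_pairK p : cancel (relabel_pair p) (relabel_pair p^-1%g).
Proof.
case=> H1 H2; rewrite /relabel_pair /= -relabel_mul -imset_comp mulgV.
congr (_, _).
  by rewrite -[RHS]imset_id; apply: eq_imset => x /=; rewrite permK.
rewrite /relabel -[RHS]imset_id; apply: eq_imset => e.
by rewrite -[RHS]imset_id; apply: eq_imset => x; rewrite perm1.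
Qed.

Lemma relabel_pair_copies p H : (relabel_pair p H \in copies Gam n) = (H \in copies Gam n).
Proof.
have stable s H' : H' \in copies Gam n -> relabel_pair s H' \in copies Gam n.
  move=> /copiesP[f f_inj ->]; apply/copiesP.
  exists (fun x => s (f x)); first by move=> x y /perm_inj/f_inj.
  by rewrite /relabel_pair relabel_embedded -imset_comp.
apply/idP/idP; last exact: stable.
by move=> /(stable p^-1%g); rewrite relabel_pairK.
Qed.

(* Averaging [F] over the copies and averaging it over the copies and over the
   relabellings give the same value, since each relabelling permutes the copies;
   by transitivity the inner average over relabellings does not depend on the copy. *)
Lemma avg_copies (F : eset -> R) :
  avg (copies Gam n) (fun H => F H.2)
  = avg [set: {perm 'I_n}] (fun p => F (relabel p (embedded_edges f0))).
Proof.
have copies0 : (0 < #|copies Gam n|)%N.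
  by apply/card_gt0P; exists ([set f0 x | x : vert Gam], embedded_edges f0);
     apply/copiesP; exists f0.
transitivity (avg (copies Gam n)
    (fun H => avg [set: {perm 'I_n}] (fun p => F (relabel p H.2)))).
  rewrite avg_exchange -[LHS](avg_const _ (card_perms_gt0 'I_n)); apply: eq_avg => p _.
  rewrite /avg; congr (_ * _); rewrite [LHS](reindex_inj (can_inj (@relabel_pairK p))) /=.
  by apply: eq_bigl => H; rewrite relabel_pair_copies.
rewrite -[RHS](avg_const _ copies0); apply: eq_avg => H /copiesP[f f_inj ->] /=.
have [s sE] := perm_extension f0_inj f_inj.
rewrite -[RHS](avg_perm_mull s); apply: eq_avg => p _.
rewrite relabel_mul (relabel_embedded s); congr (F (relabel _ (embedded_edges _))).
by apply/funext => x; rewrite sE.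
Qed.
End Copies.

(** * Detection bound for an embedded graph with centres [C] and leaves [L] *)

Lemma transcript_law_avg (R : realType) (n : nat) (I : finType) (A : {set I})
    (Q : {set {set 'I_n}}) (P : I -> {set {set 'I_n}} -> R) t :
  @transcript_law R n (fun E => avg A (P^~ E)) Q t
  = avg A (fun i => @transcript_law R n (P i) Q t).
Proof. by rewrite /transcript_law avg_sum. Qed.

Lemma relabelS n (p : {perm 'I_n}) (E F : {set {set 'I_n}}) :
  E \subset F -> relabel p E \subset relabel p F.
Proof. exact: imsetS. Qed.

Lemma relabel_pairs n (p : {perm 'I_n}) (E : {set {set 'I_n}}) :
  E \subset pairs n -> relabel p E \subset pairs n.
Proof.
move=> sE; apply/fintype.subsetP => _ /imsetP[e /(fintype.subsetP sE) + ->].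
by rewrite !inE card_imset //; apply: perm_inj.
Qed.

Lemma imset_perm_id (T : finType) (U e : {set T}) (s : {perm T}) :
  perm_on (~: U) s -> e \subset U -> [set s x | x in e] = e.
Proof.
move=> sU eU; rewrite -[RHS]imset_id; apply: eq_in_imset => x xe.
by rewrite (out_perm sU) // inE negbK (fintype.subsetP eU).
Qed.

Section CoveredCopy.
Variables (R : realType) (q : R) (n : nat).
Hypotheses (q0 : 0 < q) (q1 : q < 1).
Local Notation eset := {set {set 'I_n}}.
Local Notation perms := [set: {perm 'I_n}].
Variables (C L : {set 'I_n}) (E0 : eset).
Hypotheses (sLC : L \subset ~: C) (sE0 : E0 \subset pairs n)
  (E0C : forall e, e \in E0 -> ~~ [disjoint e & C])
  (E0L : forall e, e \in E0 -> e \subset C :|: L).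

Definition inner_edges : eset := [set e in E0 | e \subset C].

Lemma inner_edges_sub : inner_edges \subset E0.
Proof. by apply/fintype.subsetP => e; rewrite inE => /andP[]. Qed.

Lemma relabel_inner s : s \in perms_on (~: C) -> relabel s inner_edges = inner_edges.
Proof.
rewrite inE => sC; rewrite /relabel -[RHS]imset_id; apply: eq_in_imset => e.
by rewrite inE => /andP[_ eC]; rewrite (imset_perm_id sC).
Qed.

Lemma outer_edgeP e : e \in E0 -> ~~ (e \subset C) ->
  exists c l, [/\ c \in C, l \in L & e = [set c; l]].
Proof.
move=> eE /subsetPn[l le lC]; have := E0C eE.
rewrite -setI_eq0 => /set0Pn[c /setIP[ce cC]].
have := fintype.subsetP (E0L eE) _ le; rewrite inE (negbTE lC) /= => lL.
exists c, l; split=> //; apply/esym/eqP; rewrite eqEcard.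
have := fintype.subsetP sE0 _ eE; rewrite inE => /eqP ->.
rewrite cards2; have -> /= : c != l by apply: contraNneq lC => <-.
by rewrite finset.subUset !finset.sub1set ce le.
Qed.

(** * Outer edges, with the positions of the centres known *)

Section OuterEdges.
Variables (Q : eset) (p : {perm 'I_n}).
Hypothesis sQP : Q \subset pairs n.

(** Vertices are recorded before the relabelling by [p], so that this set can be intersected
    directly with the leaf sets moved by [s]. *)
Definition queried_nbrs : {set 'I_n} :=
  [set v in ~: C | [exists c in C, [set p c; p v] \in Q]].

(** Both [s] and [s'] fix the centres, so a shared outer edge joins a centre to a leaf position
    common to both placements. Each such position carries at most [#|C|] edges. *)
Lemma outer_overlap s s' : s \in perms_on (~: C) -> s' \in perms_on (~: C) ->
  (#|((relabel (s * p) E0 :&: Q) :&: (relabel (s' * p) E0 :&: Q))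
      :\: (relabel p inner_edges :&: Q)|
   <= #|C| * #|[set s x | x in L] :&: [set s' x | x in L] :&: queried_nbrs|)%N.
Proof.
move=> sK s'K; rewrite -cardsX.
set V := _ :&: queried_nbrs.
pose h (x : 'I_n * 'I_n) := [set p x.1; p x.2].
apply: leq_trans (leq_imset_card h _); apply: subset_leq_card.
apply/fintype.subsetP => e; rewrite !inE !relabel_mul.
case/andP=> + /andP[/andP[+ eQ] /andP[+ _]]; rewrite eQ andbT => eB.
case/imsetP=> _ /imsetP[e1 e1E ->] ee1 /imsetP[_ /imsetP[e2 e2E ->] ee2].
have sC : perm_on (~: C) s by rewrite inE in sK.
have s'C : perm_on (~: C) s' by rewrite inE in s'K.
(* An edge inside [C] is fixed by [s] and [s'], hence would belong to the inner edges that were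
   removed. *)
have e1C : ~~ (e1 \subset C).
  apply: contra eB => e1C; rewrite ee1 (imset_perm_id sC) //.
  by apply: imset_f; rewrite inE e1E.
have e2C : ~~ (e2 \subset C).
  apply: contra eB => e2C; rewrite ee2 (imset_perm_id s'C) //.
  by apply: imset_f; rewrite inE e2E.
have [c [l [cC lL e1_eq]]] := outer_edgeP e1E e1C.
have [c' [l' [c'C l'L e2_eq]]] := outer_edgeP e2E e2C.
have [sc s'c'] : s c = c /\ s' c' = c' by split;
  rewrite (out_perm _ (_ : _ \notin ~: C)) ?inE ?negbK.
have slC : s l \in ~: C by rewrite (perm_closed _ sC) (fintype.subsetP sLC).
have sll' : s l = s' l'.
  have : s l \in [set s' x | x in e2].
    have -> : [set s' x | x in e2] = [set s x | x in e1].
      by apply: (imset_inj (@perm_inj _ p)); rewrite -ee1 -ee2.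
    by rewrite imset_f // e1_eq !inE eqxx orbT.
  rewrite e2_eq imsetU1 imset_set1 s'c' !inE => /orP[/eqP slc'|/eqP //].
  by move: slC; rewrite slc' inE c'C.
have e_eq : e = h (c, s l).
  by rewrite ee1 e1_eq !imsetU1 !imset_set1 sc.
apply/imsetP; exists (c, s l) => //.
rewrite !inE /= cC imset_f // sll' imset_f //= -sll'.
move: slC; rewrite inE => -> /=.
by apply/existsP; exists c; rewrite cC -[[set _; _]]/(h (c, s l)) -e_eq.
Qed.

Local Notation lam := (q^-1 ^+ #|C| - 1).
Local Notation r := (#|L|%:R / #|~: C|%:R : R).

Lemma lam_ge0 : 0 <= lam.
Proof. by rewrite subr_ge0 exprn_ege1 // invf_ge1 // ltW. Qed.

(** Second moment method with the inner edges as the common planted set; the overlap is controlled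
    by the number of shared leaf positions among the queried neighbours. *)
Lemma outer_stage (eta : R) : 0 < eta -> eta <= 2^-1 ->
  transcript_dTV Q (fun E => avg (perms_on (~: C)) (fun s
    => planted_law q (relabel (s * p) E0) E))
    (planted_law q (relabel p inner_edges))
  <= #|queried_nbrs|%:R * (lam * r ^+ 2) / eta + eta.
Proof.
move=> eta0 eta1; set K := perms_on (~: C); set x := lam * r ^+ 2; set k := #|queried_nbrs|.
have K0 : (0 < #|K|)%N := perms_on_gt0 _.
have x0 : 0 <= x by rewrite mulr_ge0 ?lam_ge0 ?exprn_ge0 ?divr_ge0.
(* If [k * x] exceeds 1/2, then [k * x / eta] is at least 1 because [eta] is at most 1/2, and the
   trivial bound 1 suffices. *)
have [small|large] := leP (k%:R * x) 2^-1; last first.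
  apply: (@le_trans _ _ 1).
    apply: transcript_dTV_le1.
    - by move=> E; rewrite mulr_ge0 ?invr_ge0 ?ler0n ?sumr_ge0 // => s _;
      apply: planted_law_ge0.
    - exact: planted_law_ge0.
    - rewrite -avg_sum -[RHS](avg_const 1 K0); apply: eq_avg => s _; exact: planted_law_sum.
    - exact: planted_law_sum.
  have : 1 <= k%:R * x / eta by rewrite ler_pdivlMr //; lra.
  lra.
(* Planted sets are cut down to [Q] before passing to the whole graph, so that only queried overlaps
   enter the second moment. *)
have -> : transcript_dTV Q (fun E => avg K (fun s => planted_law q (relabel (s * p) E0) E))
    (planted_law q (relabel p inner_edges))
  = transcript_dTV Q (fun E => avg K (fun s => planted_law q (relabel (s * p) E0 :&: Q) E))
    (planted_law q (relabel p inner_edges :&: Q)).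
  congr (dTV _ _); apply/funext => t; last exact: transcript_planted.
  rewrite (transcript_law_avg K (fun s => planted_law q (relabel (s * p) E0))).
  rewrite (transcript_law_avg K (fun s => planted_law q (relabel (s * p) E0 :&: Q))).
  by apply: eq_avg => s _; apply: transcript_planted.
apply: le_trans (transcript_dTV_le _ _ _) _.
have sB s : s \in K -> relabel p inner_edges :&: Q \subset relabel (s * p) E0 :&: Q.
  move=> sK; apply: finset.setSI; rewrite -(relabel_inner sK) -relabel_mul.
  exact/relabelS/inner_edges_sub.
have sP s : s \in K -> relabel (s * p) E0 :&: Q \subset pairs n.
  by move=> _; apply: fintype.subset_trans sQP; apply: finset.subsetIr.
have := second_moment_bound q0 q1 K0 sB sP eta0.
set M := avg K _; set N := \sum_(E in _) _ => le_N.
have M1 : M - 1 <= 2 * (k%:R * x).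
  rewrite lerBlDl; apply: le_trans (Bernoulli_upper x0 small).
  apply: le_trans (avg_overlap_exp sLC queried_nbrs lam_ge0).
  apply: avg_le => s sK; apply: avg_le => s' s'K.
  (* Here [1 + lam] is [q^-1 ^+ #|C|], the largest contribution of one shared leaf position. *)
  rewrite addrC subrK -exprM ler_weXn2l ?invf_ge1 ?ltW //.
  exact: outer_overlap.
have : (M - 1) / eta <= 2 * (k%:R * x) / eta by rewrite ler_wpM2r // invr_ge0 ltW.
have : 0 <= k%:R * x / eta by rewrite divr_ge0 ?(ltW eta0) // mulr_ge0.
rewrite -[2 * _ / eta]mulrA; lra.
Qed.

Definition query_degree (v : 'I_n) : nat := #|[set e in Q | v \in e]|.

(** Union bound over the centres: for a fixed centre, distinct vertices outside [C] give distinct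
    queries at that centre. *)
Lemma queried_nbrs_le : (#|queried_nbrs| <= \sum_(c in C) query_degree (p c))%N.
Proof.
apply: (@leq_trans (\sum_(c in C) #|[set v in ~: C | [set p c; p v] \in Q]|)).
  under eq_bigr do rewrite -sum1dep_card big_mkcond.
  rewrite exchange_big -sum1dep_card big_mkcond leq_sum // => v _ /=.
  case: ifP => // /andP[vC /existsP[c /andP[cC cvQ]]].
  by rewrite (bigD1 c) //= vC cvQ.
apply: leq_sum => c cC.
have h_inj : {in [set v in ~: C | [set p c; p v] \in Q] &, injective (fun v => [set p c;
  p v])}.
  move=> v w; rewrite !inE => /andP[vC _] /andP[wC _] e.
  have : p v \in [set p c; p w] by rewrite -e !inE eqxx orbT.
  rewrite !inE => /orP[/eqP/perm_inj vc|/eqP/perm_inj //].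
  by rewrite vc cC in vC.
rewrite -(card_in_imset h_inj); apply: subset_leq_card.
apply/fintype.subsetP => _ /imsetP[v vV ->]; move: vV; rewrite !inE => /andP[_ ->].
by rewrite eqxx.
Qed.

End OuterEdges.

Lemma sum_query_degree (Q : eset) : Q \subset pairs n ->
  (\sum_v query_degree Q v = 2 * #|Q|)%N.
Proof.
move=> sQ; rewrite /query_degree.
under eq_bigr do rewrite -sum1dep_card big_mkcondr.
rewrite exchange_big /= mulnC -sum_nat_const; apply: eq_bigr => e eQ.
rewrite -big_mkcond sum1_card.
by have := fintype.subsetP sQ _ eQ; rewrite inE => /eqP.
Qed.

(** Each [p c] is uniform, and by the handshake identity the average query degree is
    [2 * #|Q| / n]. *)
Lemma avg_queried_nbrs (Q : eset) : Q \subset pairs n ->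
  avg perms (fun p => #|queried_nbrs Q p|%:R) <= #|C|%:R * (2 * #|Q|%:R / n%:R) :> R.
Proof.
move=> sQ.
apply: (@le_trans _ _ (avg perms (fun p : {perm 'I_n}
  => \sum_(c in C) (query_degree Q (p c))%:R))).
  by apply: avg_le => p _; rewrite -natr_sum ler_nat queried_nbrs_le.
rewrite avg_sum mulr_natl -sumr_const ler_sum // => c _.
rewrite (avg_perm_apply (fun v => (query_degree Q v)%:R)).
rewrite /avg cardsT card_ord mulrC ler_wpM2r ?invr_ge0 ?ler0n //.
rewrite -natr_sum -natrM ler_nat -(sum_query_degree sQ).
by apply: eq_leq; apply: eq_bigl => v; rewrite inE.
Qed.

(** * Inner edges, and the combination of the two stages *)

Lemma card_inner_edges : (#|inner_edges| <= #|C| ^ 2)%N.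
Proof.
rewrite -mulnn -cardsX.
pose h (x : 'I_n * 'I_n) := [set x.1; x.2].
apply: leq_trans (leq_imset_card h _); apply: subset_leq_card.
apply/fintype.subsetP => e; rewrite inE => /andP[/(fintype.subsetP sE0) + eC].
rewrite inE => /cards2P[x [y [_ e_eq]]]; apply/imsetP; exists (x, y) => //.
by move: eC; rewrite e_eq finset.subUset !finset.sub1set !inE.
Qed.

(** Second moment method for the entire graph, with empty common planted set. Two relabellings
    sharing an inner edge must share the position of a centre, which has probability at most
    [#|C| ^ 2 / n]. *)
Lemma inner_stage (Q : eset) (eta : R) : 0 < eta ->
  transcript_dTV Q (fun E => avg perms (fun p => planted_law q (relabel p inner_edges) E))
    (@graph_law0 R q n)
  <= q^-1 ^+ (#|C| ^ 2) * #|C|%:R ^+ 2 / n%:R / eta + eta.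
Proof.
move=> eta0; rewrite -(funext (@planted_law_set0 R q n)).
have sin : inner_edges \subset pairs n by apply: fintype.subset_trans sE0;
  apply: inner_edges_sub.
apply: le_trans (transcript_dTV_le _ _ _) _.
have := second_moment_bound q0 q1 (card_perms_gt0 'I_n)
  (fun p _ => finset.sub0set (relabel p inner_edges)) (fun p _ => relabel_pairs p sin) eta0.
set M := avg _ (fun i => avg _ _); set N := \sum_(E in _) _ => le_N.
set Z := q^-1 ^+ _ * _.
have M1 : M - 1 <= Z / n%:R.
  rewrite lerBlDl.
  (* The power is 1 when the overlap is empty. Otherwise some indicator equals 1, and its
     coefficient dominates the power since there are at most [#|C| ^ 2] inner edges. *)
  apply: (@le_trans _ _ (avg perms (fun p' : {perm 'I_n} => avg perms (fun p
    : {perm 'I_n} =>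
      1 + q^-1 ^+ (#|C| ^ 2) * \sum_(c in C) (p c \in [set p' x | x in C])%:R)))).
    rewrite /M avg_exchange; apply: avg_le => p' _; apply: avg_le => p _;
      rewrite finset.setD0.
    have [->|/set0Pn[e]] := eqVneq (relabel p inner_edges
      :&: relabel p' inner_edges) finset.set0.
      by rewrite cards0 expr0 lerDl mulr_ge0 ?exprn_ge0 ?invr_ge0 ?(ltW q0) ?sumr_ge0.
    case/setIP=> /imsetP[e1 + ee1] /imsetP[e2 + ee2].
    rewrite !inE => /andP[e1E e1C] /andP[e2E e2C].
    have /card_gt0P[c ce1] : (0 < #|e1|)%N.
      by have := fintype.subsetP sE0 _ e1E; rewrite inE => /eqP ->.
    have cC := fintype.subsetP e1C _ ce1.
    have pc : p c \in [set p' x | x in C].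
      apply: (fintype.subsetP (imsetS _ e2C)); rewrite -ee2 ee1; exact: imset_f.
    rewrite -[leLHS]add0r lerD // -[leLHS]mulr1 ler_pM ?exprn_ge0 ?invr_ge0 ?(ltW q0) //.
      rewrite ler_weXn2l ?invf_ge1 ?ltW //; apply: leq_trans card_inner_edges.
      apply: leq_trans (leq_imset_card _ _); apply: subset_leq_card; exact: finset.subsetIl.
    by rewrite (bigD1 c) //= pc lerDl sumr_ge0.
  rewrite -[leRHS](avg_const _ (card_perms_gt0 'I_n)); apply: avg_le => p' _.
  rewrite avgD (avg_const 1 (card_perms_gt0 'I_n)) lerD2l avgZ /Z -mulrA.
  rewrite ler_wpM2l ?exprn_ge0 ?invr_ge0 ?(ltW q0) //.
  rewrite avg_sum expr2 -mulrA mulr_natl -sumr_const ler_sum // => c _.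
  rewrite (avg_perm_apply (fun v => (v \in [set p' x | x in C])%:R)).
  rewrite /avg cardsT card_ord mulrC ler_wpM2r ?invr_ge0 ?ler0n //.
  rewrite -natr_sum ler_nat -(card_imset C (@perm_inj _ p')) -sum1_card big_mkcond.
  by rewrite [X in (_ <= X)%N]big_mkcond leq_sum // => v _; rewrite inE; case: (_ \in _).
have : (M - 1) / eta <= Z / n%:R / eta by rewrite ler_wpM2r // invr_ge0 ltW.
have : 0 <= Z / n%:R / eta.
  by rewrite divr_ge0 ?(ltW eta0) // divr_ge0 // mulr_ge0 ?exprn_ge0 ?invr_ge0 ?(ltW q0).
lra.
Qed.

(** The intermediate law plants the inner edges only. Convexity reveals [p] in the outer stage,
    whose bound is linear in the number of queried neighbours and can be averaged over [p]; each
    stage contributes one [eta]. *)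
Lemma transcript_dTV_bound (Q : eset) (eta : R) : Q \subset pairs n ->
    0 < eta -> eta <= 2^-1 ->
  transcript_dTV Q (fun E => avg perms (fun p => planted_law q (relabel p E0) E))
    (@graph_law0 R q n)
  <= (q^-1 ^+ #|C| - 1) * (#|L|%:R / #|~: C|%:R) ^+ 2 * (#|C|%:R * (2 * #|Q|%:R / n%:R)) / eta
     + q^-1 ^+ (#|C| ^ 2) * #|C|%:R ^+ 2 / n%:R / eta + 2 * eta.
Proof.
move=> sQ eta0 eta1.
apply: le_trans (transcript_dTV_triangle _ _
  (fun E => avg perms (fun p => planted_law q (relabel p inner_edges) E)) _) _.
have := inner_stage Q eta0; set T2 := transcript_dTV _ _ (@graph_law0 R q n) => T2_le.
set T1 := transcript_dTV _ _ _.
suff : T1 <= (q^-1 ^+ #|C| - 1) * (#|L|%:R / #|~: C|%:R) ^+ 2 * (#|C|%:R * (2 * #|Q|%:R / n%:R)) / eta + eta.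
  by lra.
have -> : T1 = transcript_dTV Q
    (fun E => avg perms (fun p => avg (perms_on (~: C)) (fun s
      => planted_law q (relabel (s * p) E0) E)))
    (fun E => avg perms (fun p => planted_law q (relabel p inner_edges) E)).
  by apply: eq_transcript_dTV => // E; rewrite (avg_perm_split _ (perms_on_gt0 (~: C))).
apply: le_trans (transcript_dTV_avg _ _ _ _) _.
apply: le_trans (avg_le (fun p _ => outer_stage p sQ eta0 eta1)) _.
rewrite avgD (avg_const eta (card_perms_gt0 'I_n)) lerD2r.
under eq_avg => p _ do rewrite -mulrA mulrC.
rewrite avgZ [leRHS]mulrAC ler_wpM2l ?avg_queried_nbrs //.
by rewrite divr_ge0 ?(ltW eta0) // mulr_ge0 ?lam_ge0 // exprn_ge0 ?divr_ge0.
Qed.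

End CoveredCopy.

(** * Vertex covers and the bound for a single graph *)

Lemma min_vertex_cover (Gam : sgraph) : exists2 C : {set vert Gam},
  is_vertex_cover C & #|C| = vertex_cover_number Gam.
Proof.
apply: (big_ind (fun k => exists2 C : {set vert Gam}, is_vertex_cover C & #|C| = k)).
- exists [set: vert Gam]; last by rewrite cardsT.
  apply/forall_inP => e; rewrite inE => /existsP[x /existsP[y /andP[_ /eqP ->]]].
  by rewrite -setI_eq0 finset.setIT; apply/set0Pn; exists x; rewrite !inE eqxx.
- move=> k1 k2 [C1 cov1 c1] [C2 cov2 c2]; rewrite /minn.
  by case: ifP => _; [exists C1 | exists C2].
- by move=> C covC; exists C.
Qed.

Section GraphBound.
Variables (R : realType) (q : R) (n : nat) (Gam : sgraph).
Hypotheses (q0 : 0 < q) (q1 : q < 1) (size_n : (#|vert Gam| <= n)%N)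
  (noiso : no_isolated Gam).

Lemma mem_edges (x y : vert Gam) : adj x y -> [set x; y] \in edges Gam.
Proof. by move=> xy; rewrite inE; apply/existsP; exists x; apply/existsP; exists y;
  rewrite xy eqxx. Qed.

Lemma cover_adj (C : {set vert Gam}) x y : is_vertex_cover C -> adj x y ->
  (x \in C) || (y \in C).
Proof.
move=> /forall_inP covC /mem_edges/covC; rewrite -setI_eq0 => /set0Pn[z].
by rewrite !inE => /andP[/orP[] /eqP -> ->]; rewrite ?orbT.
Qed.

(** A vertex outside the cover has a neighbour, which must lie in the cover; each cover vertex
    accounts for at most [max_degree Gam] of them. *)
Lemma card_cover_compl (C : {set vert Gam}) : is_vertex_cover C ->
  (#|~: C| <= #|C| * max_degree Gam)%N.
Proof.
move=> covC; rewrite -sum_nat_const.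
apply: (@leq_trans (\sum_(x in C) #|[set y | adj x y]|)); last first.
  by apply: leq_sum => x _; rewrite /max_degree (leq_bigmax x).
under eq_bigr do rewrite -sum1dep_card big_mkcond.
rewrite exchange_big -sum1_card big_mkcond leq_sum // => y _ /=.
rewrite inE; case: ifP => // yC; have [x yx] := noiso y.
have xC : x \in C by have := cover_adj covC yx; rewrite (negbTE yC).
by rewrite (bigD1 x) //= adj_sym yx.
Qed.

(** The constant 8 is 4 times 2: at least half of the vertices are not centres, so the squared leaf
    density gains a factor 4, and the handshake identity gives the 2. *)
Lemma graph_dTV_bound (Q : {set {set 'I_n}}) (eta : R) (t : nat) :
    Q \subset pairs n -> 0 < eta -> eta <= 2^-1 ->
    (vertex_cover_number Gam <= t)%N -> (2 * t <= n)%N -> (0 < n)%N ->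
  transcript_dTV Q (graph_law1 q Gam) (@graph_law0 R q n)
  <= 8 * t%:R ^+ 3 * q^-1 ^+ t * ((max_degree Gam)%:R ^+ 2 * #|Q|%:R / n%:R ^+ 3) / eta
     + q^-1 ^+ (t ^ 2) * t%:R ^+ 2 / n%:R / eta + 2 * eta.
Proof.
move=> sQ eta0 eta1 vct t2n n0.
have [C covC cardC] := min_vertex_cover Gam; rewrite -cardC in vct.
(* Any embedding would do, since averaging over relabellings recovers the uniform copy. *)
pose f0 (x : vert Gam) := widen_ord size_n (enum_rank x).
have f0_inj : injective f0.
  by move=> x y /(congr1 val) /= e; apply: enum_rank_inj; apply: val_inj.
pose C0 := [set f0 x | x in C]; pose L0 := [set f0 x | x in ~: C].
have sLC : L0 \subset ~: C0.
  apply/fintype.subsetP => _ /imsetP[x xC ->]; rewrite inE mem_imset //.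
  by rewrite inE in xC.
have sE0 : embedded_edges f0 \subset pairs n.
  apply/fintype.subsetP => _ /imsetP[e + ->].
  rewrite !inE => /existsP[x /existsP[y /andP[xy /eqP ->]]].
  rewrite card_imset // cards2; have -> // : x != y by apply: contraTneq xy => ->;
    rewrite adj_irr.
have E0C e : e \in embedded_edges f0 -> ~~ [disjoint e & C0].
  case/imsetP=> e' e'E ->; have := forall_inP covC _ e'E.
  by rewrite imset_disjoint.
have E0L e : e \in embedded_edges f0 -> e \subset C0 :|: L0.
  case/imsetP=> e' _ ->; rewrite /C0 /L0 -imsetU finset.setUCr; apply: imsetS.
  exact: finset.subsetT.
have := transcript_dTV_bound q0 q1 sLC sE0 E0C E0L sQ eta0 eta1.
have <- : graph_law1 q Gam =
    (fun E => avg [set: {perm 'I_n}] (fun p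
      => planted_law q (relabel p (embedded_edges f0)) E)).
  by apply/funext => E; rewrite -(avg_copies f0_inj (fun S => planted_law q S E)).
move=> /le_trans; apply.
have cC0 : #|C0| = #|C| by apply: card_imset.
have cL0 : (#|L0| <= t * max_degree Gam)%N.
  rewrite card_imset //; apply: leq_trans (card_cover_compl covC) _.
  by rewrite leq_mul2r vct orbT.
rewrite cC0; set c := #|C| in vct *; set D := max_degree Gam in cL0 *.
have nR : 0 < n%:R :> R by rewrite ltr0n.
have iq : 1 <= q^-1 by rewrite invf_ge1 ?ltW.
have iq0 k : 0 <= q^-1 ^+ k by rewrite exprn_ge0 // (le_trans _ iq).
have ct : c%:R <= t%:R :> R by rewrite ler_nat.
rewrite lerD2r lerD //; rewrite ler_wpM2r ?invr_ge0 ?(ltW eta0) //; last first.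
  rewrite ler_wpM2r ?invr_ge0 ?(ltW nR) // ler_pM ?iq0 ?exprn_ge0 //.
    by rewrite ler_weXn2l // leq_exp2r.
  by rewrite ler_pXn2r // nnegrE.
have cC0' : n%:R / 2 <= #|~: C0|%:R :> R.
  rewrite ler_pdivrMr // -natrM ler_nat cardsCs finset.setCK card_ord cC0.
  have c2n : (c + c <= n)%N by rewrite addnn -mul2n (leq_trans _ t2n) // leq_mul2l vct orbT.
  have cn : (c <= n)%N by apply: leq_trans c2n; apply: leq_addr.
  by rewrite muln2 -addnn -{1}(subnK cn) leq_add2l leq_subRL.
have r_le : #|L0|%:R / #|~: C0|%:R <= 2 * t%:R * D%:R / n%:R :> R.
  have -> : 2 * t%:R * D%:R / n%:R = (t%:R * D%:R) / (n%:R / 2) :> R by field;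
    rewrite gt_eqF.
  have n2 : 0 < n%:R / 2 :> R by rewrite divr_gt0.
  rewrite ler_pM ?invr_ge0 //; first by rewrite -natrM ler_nat.
  by rewrite lef_pV2 // posrE // (lt_le_trans n2).
have -> : 8 * t%:R ^+ 3 * q^-1 ^+ t * (D%:R ^+ 2 * #|Q|%:R / n%:R ^+ 3) =
  q^-1 ^+ t * (2 * t%:R * D%:R / n%:R) ^+ 2 * (t%:R * (2 * #|Q|%:R / n%:R)).
  by field; rewrite !gt_eqF.
have lam_le : q^-1 ^+ c - 1 <= q^-1 ^+ t.
  have : q^-1 ^+ c <= q^-1 ^+ t by rewrite ler_weXn2l.
  lra.
have lam0 : 0 <= q^-1 ^+ c - 1 by rewrite subr_ge0 exprn_ege1.
have r0 : 0 <= #|L0|%:R / #|~: C0|%:R :> R by rewrite divr_ge0.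
have Q0 : 0 <= 2 * #|Q|%:R / n%:R :> R by rewrite divr_ge0 ?mulr_ge0.
rewrite ler_pM ?mulr_ge0 ?exprn_ge0 ?divr_ge0 //.
  by rewrite ler_pM ?exprn_ge0 // ler_pXn2r // nnegrE (le_trans r0).
by rewrite ler_wpM2r.
Qed.

End GraphBound.

(** * From uniform bounds to the optimal risk, and the limit *)

Lemma optimal_risk_dist (R : realType) (q : R) (n : nat) (Gam : sgraph) (b : nat) (d : R) :
    (forall Q : {set {set 'I_n}}, Q \subset pairs n -> (#|Q| <= b)%N ->
       transcript_dTV Q (graph_law1 q Gam) (@graph_law0 R q n) <= d) ->
  `|1 - optimal_risk q n Gam b| <= d.
Proof.
move=> le_d; rewrite /optimal_risk opprB addrC subrK.
set A := (X in sup X).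
have A_le : ubound A d by move=> _ [Q [sQ cQ] <-]; apply: le_d.
pose x0 := transcript_dTV finset.set0 (graph_law1 q Gam) (@graph_law0 R q n).
(* The empty query set makes the family nonempty; together with the bound [d] this makes [sup] a
   genuine supremum. *)
have Ax0 : A x0 by exists finset.set0 => //; split; rewrite ?finset.sub0set ?cards0.
have x0_ge0 : 0 <= x0 by rewrite mulr_ge0 ?invr_ge0 // sumr_ge0.
rewrite ger0_norm; first by apply: ge_sup => //; exists x0.
by apply: le_trans x0_ge0 _; apply: ub_le_sup => //; exists d.
Qed.

Theorem corollary6 (R : realType) (q : R) (hq0 : 0 < q) (hq1 : q < 1)
    (Gam : nat -> sgraph)
    (hsize : forall n : nat, (2 <= n)%N -> (#|vert (Gam n)| <= n)%N)
    (hiso : forall n : nat, (2 <= n)%N -> no_isolated (Gam n))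
    (hedge : forall n : nat, (2 <= n)%N -> exists x y : vert (Gam n), adj x y)
    (tau0 : nat)
    (htau : forall n : nat, (2 <= n)%N -> (vertex_cover_number (Gam n) <= tau0)%N)
    (Q : nat -> nat)
    (hQ : ((fun n : nat => (Q n)%:R : R) =o_\oo
           (fun n : nat => n%:R ^+ 3 / (max_degree (Gam n))%:R ^+ 2 : R))%classic) :
  weak_detection_impossible q Gam Q.
Proof.
apply/cvgrPdist_le => d d0.
(* Each of the three error terms is to be at most [d / 3]. This choice handles [2 * eta]; [eps] is
   chosen so that [a * eps / eta] is at most [d / 3], with [a + 1] keeping its denominator
   positive. *)
pose eta : R := Num.min (2^-1) (d / 6).
have eta0 : 0 < eta by rewrite lt_min invr_gt0 ltr0n divr_gt0.
have eta1 : eta <= 2^-1 by rewrite ge_min lexx.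
have eta2 : 2 * eta <= d / 3.
  have : eta <= d / 6 by rewrite ge_min lexx orbT.
  lra.
pose a : R := 8 * tau0%:R ^+ 3 * q^-1 ^+ tau0.
have a0 : 0 <= a by rewrite !mulr_ge0 ?exprn_ge0 ?invr_ge0 ?(ltW hq0).
pose eps : R := eta * d / (3 * (a + 1)).
have eps0 : 0 < eps by rewrite divr_gt0 ?mulr_gt0 //; lra.
pose z : R := q^-1 ^+ (tau0 ^ 2) * tau0%:R ^+ 2.
have /eqoP/(_ eps eps0) Q_le := hQ.
near=> n; have n2 : (2 <= n)%N by near: n; exists 2%N.
have nR : 0 < n%:R :> R by rewrite ltr0n (leq_trans _ n2).
have [x [y xy]] := hedge n n2.
(* An edge forces positive maximum degree, so the quotient in [hQ] is not a division by zero. *)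
have D0 : 0 < (max_degree (Gam n))%:R :> R.
  rewrite ltr0n; apply: leq_trans (leq_bigmax x); apply/card_gt0P; exists y.
  by rewrite inE.
have Qn : (Q n)%:R <= eps * (n%:R ^+ 3 / (max_degree (Gam n))%:R ^+ 2).
  have : `|(Q n)%:R : R| <= eps * `|n%:R ^+ 3 / (max_degree (Gam n))%:R ^+ 2 : R|.
    by near: n.
  have F0 : 0 <= n%:R ^+ 3 / (max_degree (Gam n))%:R ^+ 2 :> R by rewrite divr_ge0
    ?exprn_ge0.
  by rewrite !ger0_norm //.
have zn : z / n%:R / eta <= d / 3.
  have : z / eta / (d / 3) <= n%:R by near: n; apply: nbhs_infty_ger.
  by rewrite ler_pdivrMr ?divr_gt0 // => h; rewrite mulrAC ler_pdivrMr // [leRHS]mulrC.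
apply: optimal_risk_dist => S sS cS.
apply: le_trans (graph_dTV_bound hq0 hq1 (hsize n n2) (hiso n n2) sS eta0 eta1
  (htau n n2) _ _) _; [by near: n; exists (2 * tau0)%N | by rewrite (leq_trans _ n2) |].
rewrite -/a -/z.
set X := a * _ / eta.
suff : X <= d / 3 by lra.
rewrite /X ler_pdivrMr //.
apply: (@le_trans _ _ (a * eps)).
  rewrite ler_wpM2l // ler_pdivrMr ?exprn_gt0 // -ler_pdivlMl ?exprn_gt0 //.
  apply: le_trans (_ : (Q n)%:R <= _); first by rewrite ler_nat.
  by apply: le_trans Qn _; rewrite mulrA [leLHS]mulrC.
rewrite /eps mulrA ler_pdivrMr; last by lra.
have : 0 < eta * d by rewrite mulr_gt0.
nra.
Unshelve. all: by end_near.
Qed.
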